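(* Let $p<q$ be primes. For every positive integer $b$, $$\mathrm{B}(pq^b)=\begin{cases}2, & \text{if } p=2,\\ 3\cdot 2^{\left[\frac{b-1}{2}\right]}, & \text{if } p=3.\end{cases}$$
   Context: The height $\mathrm{H}(f)$ of a polynomial $f\in\mathbb{Z}[x]$ is the largest absolute value of its coefficients. For a positive integer $n$, $\mathrm{B}(n):=\max\{\mathrm{H}(f) : f\in\mathbb{Z}[x],\ f \mid x^{n}-1\}$. $[y]$ denotes the greatest integer not exceeding $y$. *)

(* Defs.v *)
From mathcomp Require Import all_boot all_order all_algebra.
From mathcomp Require Import boolp classical_sets.

Set Implicit Arguments.
Unset Strict Implicit.
Unset Printing Implicit Defensive.

Import GRing.Theory.
Local Open Scope ring_scope.

Definition height (f : {poly int}) : nat := (\max_(i < size f) `|(f`_i)%R|)%N.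

(* Divisibility in the ring Z[x]. The relation %| of polydiv is
   pseudo-divisibility over a domain, i.e. divisibility up to a nonzero
   constant (2 would divide 1), so it is not the right notion over int. *)
Definition Zdivides (f g : {poly int}) : Prop := exists h : {poly int}, g = h * f.

Definition is_max_height (n m : nat) : Prop :=
  (exists f : {poly int}, Zdivides f ('X^n - 1) /\ height f = m) /\
  (forall f : {poly int}, Zdivides f ('X^n - 1) -> (height f <= m)%N).

(* The default value 0 is taken only when no maximum exists, as for n = 0,
   where every polynomial divides X^0 - 1 = 0. *)
Definition B (n : nat) : nat := xget 0%N [set m | is_max_height n m].

Lemma B_eq (n m : nat) : (0 < m)%N -> B n = m <-> is_max_height n m.
Proof.
move=> m_gt0; split=> [Bm|Pm].
  by move: Bm m_gt0; rewrite /B; case: xgetP => [x _ Px <-|_ <-].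
apply: xget_unique => // k [[g [dg <-]] leg].
case: Pm => [[f [df <-]] lef].
by apply/eqP; rewrite eqn_leq lef // leg.
Qed.

(* Main.v *)
(** A divisor of [X^(p q^b) - 1] is, up to sign, a product of distinct cyclotomic
    polynomials, hence has the form [(X - 1)^e psi_p^d g_b], where
    [psi_n = 1 + X + ... + X^(n-1)] and
    [g_(k+1) = psi_q^e' Phi_(pq)^d' g_k(X^q)] starting from [g_0 = 1] or [-1]. Unless
    [(e', d') = (0, 1)], every coefficient of [g_(k+1)] is zero or a coefficient
    of [g_k].  In the remaining case the multiplier is [Phi_(pq)]: for [p = 2] its
    coefficients are alternately 1 and -1 and each coefficient of [g_(k+1)] is
    again one of [g_k] up to sign, so only the last factor can reach height 2.
    For [p = 3] the coefficients are, up to sign, those of [g_k] or sums of two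
    adjacent coefficients of [g_k]; as the adjacent sums of [g_(k+1)] are at most
    twice the height of [g_k], the height of [g_b] doubles at most once in two
    steps. The outer factor costs at most 3 times the height of [g_(b-1)].
    Alternating the multipliers [psi_q] (which creates constant blocks) and
    [Phi_(3q)] attains these bounds. *)

Require Import Defs.
From mathcomp Require Import all_boot all_algebra all_field.
From mathcomp Require Import zify ring lra.

Set Implicit Arguments.
Unset Strict Implicit.
Unset Printing Implicit Defensive.

Import GRing.Theory.
Local Open Scope ring_scope.

Implicit Types (f g h A : {poly int}) (n q : nat).

(** * Cyclotomic factors of [X^(p q^b) - 1] *)

Lemma comp_XnXn (m n : nat) : ('X^m : {poly int}) \Po 'X^n = 'X^(n * m).
Proof. by rewrite comp_Xn_poly exprM. Qed.

Definition psi n : {poly int} := \sum_(i < n) 'X^i.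

Lemma psiE n : ('X - 1) * psi n = 'X^n - 1.
Proof. by rewrite /psi subrX1. Qed.

Lemma psi_compE n k : ('X^k - 1) * (psi n \Po 'X^k) = 'X^(n * k) - 1.
Proof.
have /(congr1 (fun f => f \Po 'X^k)) := psiE n.
by rewrite comp_polyM !comp_polyB comp_polyX -(polyC1 int) !comp_polyC comp_XnXn mulnC.
Qed.

Lemma Xn_sub1_neq0 n : (0 < n)%N -> 'X^n - 1 != 0 :> {poly int}.
Proof. by move=> n0; apply: monic_neq0; apply: monicXnsubC. Qed.

(** Sort the divisors by [q]-adic valuation: it is at most [k], or it equals [k.+1] and the divisor
    is [q ^ k.+1] times a divisor of [m]. *)
Lemma perm_divisors_primeX (m q k : nat) : prime q -> (0 < m)%N -> coprime q m ->
  perm_eq (divisors (m * q ^ k.+1))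
          (divisors (m * q ^ k) ++ [seq (d * q ^ k.+1)%N | d <- divisors m]).
Proof.
move=> prq m0 cop.
have q0 := prime_gt0 prq.
have qk0 i : (0 < q ^ i)%N by rewrite expn_gt0 q0.
have mq0 i : (0 < m * q ^ i)%N by rewrite muln_gt0 m0 qk0.
apply: uniq_perm.
- exact: divisors_uniq.
- rewrite cat_uniq divisors_uniq map_inj_uniq ?divisors_uniq ?andbT; last first.
    by move=> x y /eqP; rewrite eqn_pmul2r // => /eqP.
  apply/hasPn => _ /mapP[d _ ->]; rewrite -dvdn_divisors //.
  apply/negP => /(dvdn_trans (dvdn_mull d (dvdnn _))).
  rewrite expnS dvdn_pmul2r // => qm.
  by move: cop; rewrite prime_coprime // qm.
move=> d; rewrite mem_cat -!dvdn_divisors //; apply/idP/orP; last first.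
  case=> [dv|/mapP[e]]; first by rewrite expnS mulnCA dvdn_mull.
  by rewrite -dvdn_divisors // => dv ->; rewrite dvdn_mul.
move=> dv; have d0 : (0 < d)%N by case: d dv => //; rewrite dvd0n gtn_eqF.
have [e cope de] := pfactor_coprime prq d0.
have em : (e %| m)%N.
  rewrite -(@Gauss_dvdl _ _ (q ^ k.+1)); last by rewrite coprimeXr // coprime_sym.
  by apply: dvdn_trans dv; rewrite de dvdn_mulr.
have : (logn q d <= k.+1)%N.
  rewrite -(dvdn_Pexp2l _ _ (prime_gt1 prq)) -(@Gauss_dvdr _ m) ?coprimeXl //.
  by apply: dvdn_trans dv; rewrite {2}de dvdn_mull.
rewrite leq_eqVlt => /predU1P[ek|lek].
  by right; apply/mapP; exists e; rewrite -?dvdn_divisors // {1}de ek.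
by left; rewrite de dvdn_mul // dvdn_exp2l.
Qed.

Lemma Xn_sub1_primeX (m q k : nat) : prime q -> (0 < m)%N -> coprime q m ->
  'X^(m * q ^ k.+1) - 1 =
  ('X^(m * q ^ k) - 1) * \prod_(d <- divisors m) 'Phi_(d * q ^ k.+1).
Proof.
move=> prq m0 cop; have q0 := prime_gt0 prq.
rewrite -!prod_Cyclotomic ?muln_gt0 ?m0 ?expn_gt0 ?q0 //.
by rewrite (perm_big _ (perm_divisors_primeX k prq m0 cop)) big_cat big_map.
Qed.

Lemma divisors_prime p : prime p -> divisors p = [:: 1; p]%N.
Proof.
move=> prp; apply: (sorted_eq leq_trans anti_leq).
- exact: sorted_divisors.
- by rewrite /= andbT prime_gt0.
apply: uniq_perm; rewrite ?divisors_uniq //=.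
  by rewrite inE andbT neq_ltn prime_gt1.
move=> d; rewrite -dvdn_divisors ?prime_gt0 // !inE; apply/idP/idP.
  by case/primeP: prp => _; apply.
by case/orP => /eqP ->.
Qed.

Lemma Cyclotomic1 : 'Phi_1 = 'X - 1.
Proof. by rewrite -['X]expr1 -prod_Cyclotomic // big_seq1. Qed.

Lemma Cyclotomic_primeX q k : prime q -> 'Phi_(q ^ k.+1) = psi q \Po 'X^(q ^ k).
Proof.
move=> prq; have q0 := prime_gt0 prq.
apply: (mulfI (@Xn_sub1_neq0 (q ^ k) _)); first by rewrite expn_gt0 q0.
have := Xn_sub1_primeX k prq (ltn0Sn 0) (coprimen1 q).
by rewrite psi_compE -expnS big_seq1 !mul1n => ->.
Qed.

Lemma Cyclotomic_prime q : prime q -> 'Phi_q = psi q.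
Proof. by move=> /(@Cyclotomic_primeX _ 0); rewrite expn1 expn0 comp_polyXr. Qed.

(** Compare two factorizations of [X^(p q^(k+1)) - 1], one over [X^(q^(k+1)) - 1] and one over
    [X^(p q^k) - 1]. The product form avoids a division. *)
Lemma Cyclotomic_primeM p q k : prime p -> prime q -> coprime q p ->
  'Phi_(p * q ^ k.+1) * (psi p \Po 'X^(q ^ k)) = psi p \Po 'X^(q ^ k.+1).
Proof.
move=> prp prq cop; have q0 := prime_gt0 prq; have p0 := prime_gt0 prp.
have qk i : (0 < q ^ i)%N by rewrite expn_gt0 q0.
apply: (mulfI (Xn_sub1_neq0 (qk k.+1))).
rewrite psi_compE Xn_sub1_primeX // divisors_prime // big_cons big_seq1 mul1n.
rewrite -(psi_compE p) Cyclotomic_primeX // expnS -(psi_compE q).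
ring.
Qed.

Lemma Cyclotomic_primeM_comp p q k : prime p -> prime q -> coprime q p ->
  'Phi_(p * q ^ k.+1) = 'Phi_(p * q) \Po 'X^(q ^ k).
Proof.
move=> prp prq cop; have q0 := prime_gt0 prq; have p0 := prime_gt0 prp.
have psi0 : psi p \Po 'X^(q ^ k) != 0.
  have := @Xn_sub1_neq0 (p * q ^ k); rewrite muln_gt0 p0 expn_gt0 q0 => /(_ isT).
  by rewrite -psi_compE; apply: contra_neq => ->; rewrite mulr0.
apply: (mulIf psi0); rewrite Cyclotomic_primeM // -comp_polyM.
have := @Cyclotomic_primeM p q 0 prp prq cop; rewrite expn1 expn0 comp_polyXr => ->.
by rewrite -comp_polyA comp_XnXn expnSr.
Qed.

(** * Divisors in [Z[X]] *)

(** At a primitive [n]-th root of unity [z], one of the two factors vanishes. Dividing it by the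
    monic ['Phi_n] leaves a remainder that vanishes at [z] and has smaller degree than the minimal
    polynomial of [z], hence is zero. *)
Lemma Cyclotomic_Zprime n f g : (0 < n)%N ->
  Zdivides 'Phi_n (f * g) -> Zdivides 'Phi_n f \/ Zdivides 'Phi_n g.
Proof.
move=> n0 [h eq_fg]; have [z prim_z] := C_prim_root_exists n0.
have rootPhi : root (map_poly (intr : int -> algC) 'Phi_n) z.
  by rewrite (Cintr_Cyclotomic prim_z) root_cyclotomic.
have dvd u : root (map_poly (intr : int -> algC) u) z -> Zdivides 'Phi_n u.
  have := Pdiv.RingMonic.rdivp_eq (Cyclotomic_monic n) u.
  have := Pdiv.Ring.ltn_rmodpN0 u (monic_neq0 (Cyclotomic_monic n)).
  set r := Pdiv.CommonRing.rmodp _ _; set v := Pdiv.CommonRing.rdivp _ _.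
  move=> szr eq_u rootu; exists v; rewrite {1}eq_u.
  suff -> : r = 0 by rewrite addr0.
  apply/eqP; case: eqP => // /eqP r0.
  have rootr : root (map_poly (intr : int -> algC) r) z.
    move: rootu; rewrite eq_u rmorphD rmorphM /= /root hornerD hornerM.
    by rewrite (rootP rootPhi) mulr0 add0r.
  have [pf [Dpf _] dv_pf] := minCpolyP z.
  have inj_rat : injective (intr : int -> rat) by exact: intr_inj.
  have := dv_pf (map_poly intr r).
  rewrite -map_poly_comp (eq_map_poly (g := intr)); last by move=> x; rewrite /= ratr_int.
  rewrite rootr => /esym /dvdp_leq.
  rewrite -size_poly_eq0 size_map_inj_poly // size_poly_eq0 => /(_ r0).
  rewrite leqNgt => /negP[]; apply: leq_trans szr _.
  have <- : size (minCpoly z) = size pf by rewrite Dpf size_map_poly.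
  rewrite (minCpoly_cyclotomic prim_z) -(Cintr_Cyclotomic prim_z).
  by rewrite size_map_inj_poly //; exact: intr_inj.
have : root (map_poly (intr : int -> algC) (f * g)) z.
  by rewrite eq_fg rmorphM rootM rootPhi orbT.
by rewrite rmorphM rootM => /orP[] /dvd; [left|right].
Qed.

(** The prime ['Phi_n] divides either the cofactor, where it cancels ([e = false]), or [f] itself
    ([e = true]). *)
Lemma Zdivides_mul_Cyclotomic n f g : (0 < n)%N ->
  Zdivides f ('Phi_n * g) ->
  exists (e : bool) f', f = 'Phi_n ^+ e * f' /\ Zdivides f' g.
Proof.
move=> n0 [h eq_fg].
have Phi0 := monic_neq0 (Cyclotomic_monic n).
have [] := @Cyclotomic_Zprime n h f n0; first by exists g; rewrite -eq_fg mulrC.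
- case=> h' eq_h; exists false, f; split; first by rewrite mul1r.
  by exists h'; apply: (mulfI Phi0); rewrite eq_fg eq_h; ring.
case=> f' eq_f; exists true, f'; split; first by rewrite eq_f mulrC.
by exists h; apply: (mulfI Phi0); rewrite eq_fg eq_f; ring.
Qed.

Lemma Zdivides1 f : Zdivides f 1 -> f = 1 \/ f = -1.
Proof.
case=> h eq1; have : f \is a GRing.unit by apply/unitrPr; exists h; rewrite mulrC.
rewrite poly_unitE => /andP[/size_poly1P[c _ ->]]; rewrite coefC /=.
by case/orP=> /eqP ->; [left|right]; rewrite ?polyCN polyC1.
Qed.

(* The products [g_b] of the header. By [Cyclotomic_primeX] and
   [Cyclotomic_primeM_comp] they are, up to sign, the products of distinct
   [Phi_(q^k)] and [Phi_(p q^k)] with [1 <= k <= b]. *)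
Fixpoint tower (p q b : nat) (g : {poly int}) : Prop :=
  if b is b'.+1 then
    exists (e d : bool) (h : {poly int}),
      tower p q b' h /\ g = psi q ^+ e * 'Phi_(p * q) ^+ d * (h \Po 'X^q)
  else g = 1 \/ g = -1.

Lemma tower_1 p q b : tower p q b 1.
Proof.
elim: b => [|b IH] /=; first by left.
by exists false, false, 1; rewrite -(polyC1 int) comp_polyC !mul1r.
Qed.

(** For distinct primes this is the quotient of [X^(p q^(i+b)) - 1] by [X^(p q^i) - 1]. The start
    [i] varies because removing the lowest level, in the induction on [b], raises it by one. *)
Definition levels p q (i b : nat) : {poly int} :=
  \prod_(i <= k < i + b) ('Phi_(q ^ k.+1) * 'Phi_(p * q ^ k.+1)).

Lemma levelsS p q i b :
  levels p q i b.+1 = 'Phi_(q ^ i.+1) * ('Phi_(p * q ^ i.+1) * levels p q i.+1 b).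
Proof. by rewrite /levels big_ltn ?addnS ?addSn ?leq_addr // mulrA. Qed.

Lemma Xn_sub1_levels p q b : prime p -> prime q -> coprime q p ->
  'X^(p * q ^ b) - 1 = 'Phi_1 * ('Phi_p * levels p q 0 b).
Proof.
move=> prp prq cop; rewrite Cyclotomic1 Cyclotomic_prime // mulrA psiE /levels add0n.
elim: b => [|b IH]; first by rewrite big_geq // muln1 mulr1.
rewrite big_nat_recr //= mulrA -IH Xn_sub1_primeX ?prime_gt0 // divisors_prime //.
by rewrite big_cons big_seq1 mul1n.
Qed.

(* The factors are prime in [Z[X]], so a divisor picks some of them. *)
Lemma Zdivides_levels p q i b f : prime p -> prime q -> coprime q p ->
  Zdivides f (levels p q i b) <-> exists g, tower p q b g /\ f = g \Po 'X^(q ^ i).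
Proof.
move=> prp prq cop; have q0 := prime_gt0 prq; have p0 := prime_gt0 prp.
have pow_comp A (e : bool) k : A ^+ e \Po 'X^k = (A \Po 'X^k) ^+ e.
  by case: e => //; rewrite expr0 -(polyC1 int) comp_polyC.
have step i' (e d : bool) h : (psi q ^+ e * 'Phi_(p * q) ^+ d * (h \Po 'X^q)) \Po 'X^(q ^ i') =
    'Phi_(q ^ i'.+1) ^+ e * ('Phi_(p * q ^ i'.+1) ^+ d * (h \Po 'X^(q ^ i'.+1))).
  rewrite !comp_polyM !pow_comp Cyclotomic_primeX // Cyclotomic_primeM_comp //.
  by rewrite -comp_polyA comp_XnXn expnSr mulrA.
elim: b i f => [|b IH] i f.
  rewrite /levels addn0 big_geq //; split=> [/Zdivides1|[g [tg ->]]].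
    move=> f1; exists f; split=> //.
    by case: f1 => ->; rewrite ?rmorphN /= -(polyC1 int) comp_polyC.
  exists g; rewrite /= in tg; case: tg => ->.
    by rewrite -(polyC1 int) comp_polyC mulr1.
  by rewrite rmorphN /= -(polyC1 int) comp_polyC mulrN mulr1 opprK.
have pq0 k : (0 < p * q ^ k)%N by rewrite muln_gt0 p0 expn_gt0 q0.
rewrite levelsS; split.
  case/Zdivides_mul_Cyclotomic => [|e [f1 [-> /Zdivides_mul_Cyclotomic]]].
    by rewrite expn_gt0 q0.
  case=> // d [f2 [-> /IH[g [tg ->]]]].
  exists (psi q ^+ e * 'Phi_(p * q) ^+ d * (g \Po 'X^q)); split; first by exists e, d, g.
  by rewrite step.
case=> g [[e [d [h [th ->]]]] ->].
have [|u eq_u] := (IH i.+1 (h \Po 'X^(q ^ i.+1))).2; first by exists h.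
(* The cofactor takes the factors that [e] and [d] leave out. *)
exists ('Phi_(q ^ i.+1) ^+ (~~ e) * 'Phi_(p * q ^ i.+1) ^+ (~~ d) * u).
by rewrite step eq_u; case: e; case: d; rewrite ?expr0 ?expr1 ?mul1r; ring.
Qed.

Lemma Zdivides_XpqbP p q b f : prime p -> prime q -> coprime q p ->
  Zdivides f ('X^(p * q ^ b) - 1) <->
  exists (e d : bool) g, tower p q b g /\ f = ('X - 1) ^+ e * (psi p ^+ d * g).
Proof.
move=> prp prq cop; have p0 := prime_gt0 prp.
rewrite Xn_sub1_levels // -Cyclotomic1 -(Cyclotomic_prime prp).
have lvl := fun f => @Zdivides_levels p q 0 b f prp prq cop.
split.
  case/Zdivides_mul_Cyclotomic => // e [f1 [-> /Zdivides_mul_Cyclotomic]].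
  case=> // d [f2 [-> /lvl[g []]]]; rewrite comp_polyXr => tg ->.
  by exists e, d, g.
case=> e [d [g [tg ->]]].
have [|u eq_u] := (lvl g).2; first by exists g; rewrite comp_polyXr.
exists ('Phi_1 ^+ (~~ e) * 'Phi_p ^+ (~~ d) * u).
by rewrite eq_u; case: e; case: d; rewrite ?expr0 ?expr1 ?mul1r; ring.
Qed.

(** * Coefficient bounds *)

(** A bound at every index, beyond the degree as well, passes through sums and shifts without any
    mention of sizes. *)
Definition coef_le (M : nat) f := forall i, (`|(f`_i)%R| <= M)%N.

Lemma coef_leP M f : (height f <= M)%N <-> coef_le M f.
Proof.
split=> [/bigmax_leqP le_f i|le_f]; last by apply/bigmax_leqP => i _; exact: le_f.
have [lt_i|ge_i] := ltnP i (size f); first exact: (le_f (Ordinal lt_i)).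
by rewrite nth_default.
Qed.

Lemma is_max_height_coef n m :
  (forall f, Zdivides f ('X^n - 1) -> coef_le m f) ->
  (exists f i, Zdivides f ('X^n - 1) /\ `|(f`_i)%R|%N = m) -> is_max_height n m.
Proof.
move=> le_m [f [i [dvd_f fi]]]; split=> [|g /le_m /coef_leP//].
exists f; split=> //; apply/eqP; rewrite eqn_leq (coef_leP m f).2 /=; last exact: le_m.
by rewrite -fi; exact: (coef_leP (height f) f).1.
Qed.

Lemma coef_leW M N f : (M <= N)%N -> coef_le M f -> coef_le N f.
Proof. by move=> le_MN le_f i; apply: leq_trans le_MN. Qed.

Lemma coef_le_Xn M n f : coef_le M f -> coef_le M ('X^n * f).
Proof. by move=> le_f i; rewrite coefXnM; case: ifP. Qed.

Lemma coef_le_X M f : coef_le M f -> coef_le M ('X * f).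
Proof. by rewrite -['X]expr1; exact: coef_le_Xn. Qed.

Lemma coef_leD M N f g : coef_le M f -> coef_le N g -> coef_le (M + N) (f + g).
Proof.
move=> le_f le_g i; rewrite coefD; move: (le_f i) (le_g i).
by move: (f`_i) (g`_i) => x y; lia.
Qed.

Lemma coef_leB M N f g : coef_le M f -> coef_le N g -> coef_le (M + N) (f - g).
Proof.
move=> le_f le_g i; rewrite coefB; move: (le_f i) (le_g i).
by move: (f`_i) (g`_i) => x y; lia.
Qed.

Lemma coef_le_Xn_sub1 M n f : coef_le M f -> coef_le (2 * M) (('X^n - 1) * f).
Proof.
by move=> le_f; rewrite mulrBl mul1r mul2n -addnn; apply: coef_leB => //; apply: coef_le_Xn.
Qed.

Lemma coef_le_X_sub1 M f : coef_le M f -> coef_le (2 * M) (('X - 1) * f).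
Proof. by rewrite -['X]expr1; exact: coef_le_Xn_sub1. Qed.

Lemma psi2 : psi 2 = 1 + 'X.
Proof. by rewrite /psi !big_ord_recl big_ord0 addr0. Qed.

Lemma psi3 : psi 3 = 1 + 'X + 'X^2.
Proof. by rewrite /psi !big_ord_recl big_ord0 addr0 addrA. Qed.

Lemma coef_le_psi2 M f : coef_le M f -> coef_le (2 * M) (psi 2 * f).
Proof.
move=> le_f; rewrite psi2 mulrDl mul1r mul2n -addnn.
by apply: coef_leD => //; apply: coef_le_X.
Qed.

Lemma coef_le_psi3 M f : coef_le M f -> coef_le (3 * M) (psi 3 * f).
Proof.
move=> le_f; rewrite psi3 mulrDl -psi2 mulSn addnC.
by apply: coef_leD; [exact: coef_le_psi2 | exact: coef_le_Xn].
Qed.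

(** As [A] fits in a window of length [q], its shifted copies, scaled by the coefficients of [h], do
    not overlap. *)
Lemma coef_block A h q j r : (size A <= q)%N -> (r < q)%N ->
  (A * (h \Po 'X^q))`_(j * q + r) = A`_r * h`_j.
Proof.
move=> szA ltr; have q0 : (0 < q)%N by apply: leq_ltn_trans ltr.
have lt_j : (j * q < (j * q + r).+1)%N by rewrite ltnS leq_addr.
rewrite coefMr (bigD1 (Ordinal lt_j)) //= addKn coef_comp_poly_Xn // dvdn_mull //.
rewrite mulnK // big1 ?addr0 // => -[i /= lti] /eqP ne_i.
rewrite coef_comp_poly_Xn //; case: ifP => [/dvdnP[k eq_i]|_]; last by rewrite mulr0.
rewrite [A`__]nth_default ?mul0r //; apply: leq_trans szA _.
have lt_kj : (k < j)%N.
  have : (k <= j)%N by rewrite -ltnS -(ltn_pmul2r q0); nia.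
  by rewrite leq_eqVlt => /predU1P[ekj|//]; case: ne_i; apply: val_inj; rewrite /= eq_i ekj.
by rewrite eq_i; nia.
Qed.

Lemma coef_le_block A h q M : (0 < q)%N -> (size A <= q)%N -> coef_le 1 A ->
  coef_le M h -> coef_le M (A * (h \Po 'X^q)).
Proof.
move=> q0 szA le_A le_h i; rewrite (divn_eq i q) coef_block ?ltn_pmod // abszM.
by rewrite -[M]mul1n leq_mul.
Qed.

Lemma coef_psi n i : (psi n)`_i = (i < n)%:R.
Proof.
have -> : psi n = \poly_(i < n) 1 by rewrite poly_def; apply: eq_bigr => j _; rewrite scale1r.
by rewrite coef_poly; case: ifP.
Qed.

Lemma size_psi n : (size (psi n) <= n)%N.
Proof. by apply/leq_sizeP => i le_ni; rewrite coef_psi ltnNge le_ni. Qed.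

Lemma coef_le_psi_block q h M : (0 < q)%N ->
  coef_le M h -> coef_le M (psi q * (h \Po 'X^q)).
Proof.
move=> q0; apply: coef_le_block => //; first exact: size_psi.
by move=> i; rewrite coef_psi; case: ltnP.
Qed.

(* A coefficient of the product collects terms [h_j] with [j] in a fixed class
   mod [p] and in a window of length [p], hence at most one. *)
Lemma coef_le_sparse p q h M : (0 < p)%N -> (0 < q)%N -> coprime p q ->
  coef_le M h -> coef_le M ((psi q \Po 'X^p) * (h \Po 'X^q)).
Proof.
move=> p0 q0 cop le_h i; rewrite coefMr.
pose F (j : 'I_i.+1) := (psi q \Po 'X^p)`_(i - j) * (h \Po 'X^q)`_j.
rewrite -[X in `|X|%N]/(\sum_j F j).
have nz j : F j != 0 -> [/\ (p %| i - j)%N, ((i - j) < q * p)%N & (q %| j)%N].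
  rewrite /F !coef_comp_poly_Xn // coef_psi.
  case: ifP => [dp|]; last by rewrite mul0r eqxx.
  case: (ltnP (_ %/ p) q) => [lt_q|]; last by rewrite mul0r eqxx.
  by case: ifP => [dq|]; [rewrite -ltn_divLR | rewrite mulr0 eqxx].
have leF j : (`|F j| <= M)%N.
  rewrite /F !coef_comp_poly_Xn // coef_psi.
  case: ifP => [_|]; last by rewrite mul0r.
  case: (_ < q)%N; last by rewrite mul0r.
  by rewrite mul1r; case: ifP.
have uniqF j k : F j != 0 -> F k != 0 -> (j <= k)%N -> j = k.
  move=> /nz[dpj ltj dqj] /nz[dpk ltk dqk] le_jk; apply: val_inj; apply/eqP.
  have : (p * q %| k - j)%N.
    rewrite Gauss_dvd //; apply/andP; split; last exact: dvdn_sub.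
    have -> : (k - j = (i - j) - (i - k))%N by have := ltn_ord j; have := ltn_ord k; lia.
    exact: dvdn_sub.
  have [eq0|gt0] := posnP (k - j); first by move=> _; rewrite eqn_leq le_jk -subn_eq0 eq0.
  by move/(dvdn_leq gt0); have := ltn_ord k; nia.
have [j nzj|F0] := pickP (fun j => F j != 0); last first.
  by rewrite big1 // => j _; apply/eqP; rewrite -[_ == _]negbK F0.
rewrite (bigD1 j) //= big1 ?addr0 // => k ne_kj; apply/eqP; apply/negPn/negP => nzk.
case/eqP: ne_kj; case/orP: (leq_total k j) => le; first exact: uniqF.
by apply/esym; exact: uniqF.
Qed.

(** This is the case [k = 0] of [Cyclotomic_primeM] with [p] and [q] exchanged. It brings the
    multiplier with [e = d = true] into the form of [coef_le_sparse]. *)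
Lemma psi_mul_Cyclotomic p q : prime p -> prime q -> coprime q p ->
  psi q * 'Phi_(p * q) = psi q \Po 'X^p.
Proof.
move=> prp prq cop; have p0 := prime_gt0 prp.
have psi0 : 'X^p - 1 != 0 :> {poly int} by exact: Xn_sub1_neq0.
apply: (mulfI psi0); rewrite psi_compE (mulnC q p) -psi_compE -psiE.
have := @Cyclotomic_primeM p q 0 prp prq cop; rewrite expn1 expn0 comp_polyXr => <-.
by rewrite -(psiE q); ring.
Qed.

(** Three multipliers are possible: the sparse [psi q \Po 'X^p], and [psi q] and 1, which fit in one
    block with coefficients 0 and 1. *)
Lemma coef_le_step p q h M (e d : bool) : prime p -> prime q -> coprime q p ->
  e || ~~ d -> coef_le M h ->
  coef_le M (psi q ^+ e * 'Phi_(p * q) ^+ d * (h \Po 'X^q)).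
Proof.
move=> prp prq cop; have q0 := prime_gt0 prq.
case: e d => [] [] //= _ le_h; rewrite ?expr0 ?expr1.
- by rewrite psi_mul_Cyclotomic //; apply: coef_le_sparse; rewrite ?prime_gt0 // coprime_sym.
- by rewrite mulr1; exact: coef_le_psi_block.
rewrite mulr1; apply: coef_le_block => //; first by rewrite size_poly1.
by move=> i; rewrite coef1; case: eqP.
Qed.

(** * The case [p = 2] *)

(** For odd [q], both sides become [1 + X^q] after multiplication by [1 + X]. *)
Lemma Cyclotomic_double q : prime q -> odd q ->
  'Phi_(2 * q) = \poly_(i < q) (-1) ^+ i.
Proof.
move=> prq oddq; have cop : coprime q 2 by rewrite coprimen2.
have psi20 : psi 2 != 0.
  have := @Xn_sub1_neq0 2 isT; rewrite -psiE; apply: contra_neq => ->.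
  by rewrite mulr0.
apply: (mulIf psi20).
have := @Cyclotomic_primeM 2 q 0 isT prq cop; rewrite expn1 expn0 comp_polyXr => ->.
have -> : \poly_(i < q) (-1) ^+ i = \sum_(i < q) (- 'X) ^+ i :> {poly int}.
  by rewrite poly_def; apply: eq_bigr => i _; rewrite -scaleN1r exprZn.
have := subrX1 (- 'X : {poly int}) q.
rewrite exprNn -signr_odd oddq mulN1r => eqX.
rewrite psi2 comp_polyD comp_polyX -(polyC1 int) comp_polyC.
by apply: oppr_inj; rewrite polyC1 opprD addrC eqX; ring.
Qed.

Lemma tower2_coef_le q b g : prime q -> (2 < q)%N -> tower 2 q b g -> coef_le 1 g.
Proof.
move=> prq q_gt2; have oddq : odd q by case: (even_prime prq) q_gt2 => // ->.
have cop : coprime q 2 by rewrite coprimen2.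
elim: b g => [|b IH] g /=; first by case=> -> i; rewrite ?coefN coef1; case: eqP.
case=> e [d [h [/IH le_h ->]]].
have [ed|] := boolP (e || ~~ d); first exact: coef_le_step.
rewrite negb_or negbK => /andP[/negbTE -> ->]; rewrite mul1r expr1 Cyclotomic_double //.
apply: coef_le_block => //; first exact: prime_gt0.
by move=> i; rewrite coef_poly; case: ifP => // _; rewrite -signr_odd; case: odd.
Qed.

Lemma B_double q b : prime q -> (2 < q)%N -> (0 < b)%N -> B (2 * q ^ b) = 2%N.
Proof.
move=> prq q_gt2; have oddq : odd q by case: (even_prime prq) q_gt2 => // ->.
have cop : coprime q 2 by rewrite coprimen2.
case: b => // b _; apply/B_eq => //; apply: is_max_height_coef.
  move=> f /Zdivides_XpqbP[]// e [d [g [/tower2_coef_le-/(_ prq q_gt2) le_g ->]]].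
  (* The outer factor is [X^2 - 1], [X - 1], [1 + X] or 1: at most two coefficients, each 1 or
     -1. *)
  case: e d => [] []; rewrite ?expr0 ?expr1 ?mul1r.
  - by rewrite mulrA psiE; exact: (@coef_le_Xn_sub1 1).
  - by exact: (@coef_le_X_sub1 1).
  - by exact: (@coef_le_psi2 1).
  exact: coef_leW le_g.
(* As ['Phi_(2 * q)] begins with [1 - X], the coefficient of [X] in the product is 1 + 1. *)
exists (('X - 1) * 'Phi_(2 * q)), 1%N; split; last first.
  rewrite Cyclotomic_double // mulrBl mul1r coefB coefXM !coef_poly /=.
  by rewrite (ltnW (ltnW q_gt2)) (ltnW q_gt2).
apply/Zdivides_XpqbP => //; exists true, false, 'Phi_(2 * q); split.
  exists false, true, 1; split; first exact: tower_1.
  by rewrite -(polyC1 int) comp_polyC !mul1r mulr1.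
by rewrite mul1r.
Qed.

(** * The case [p = 3] *)

(* The coefficient at [X^(j q + r)], [r < q], of [Phi_(3q) h(X^q)] when
   [z = h_j] and [y = h_(j-1)]; it is determined by the recurrence read off
   [psi_3 Phi_(3q) h(X^q) = (psi_3 h)(X^q)]. The second branch is meant for
   [q = 2 mod 3]. *)
Definition tri q r (z y : int) : int :=
  if (q %% 3 == 1)%N then
    if (r %% 3 == 0)%N then z else if (r %% 3 == 1)%N then - (z + y) else y
  else
    if (r %% 3 == 0)%N then z + y else if (r %% 3 == 1)%N then - z else - y.

(** Strong induction on the index: three consecutive coefficients sum to one of [(psi_3 h)(X^q)],
    which is zero unless its index is a multiple of [q]. *)
Lemma coef_Phi3 q h j r : prime q -> (3 < q)%N -> (r < q)%N ->
  ('Phi_(3 * q) * (h \Po 'X^q))`_(j * q + r) = tri q r h`_j ('X * h)`_j.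
Proof.
move=> prq q_gt3.
have cop : coprime q 3.
  by rewrite prime_coprime // dvdn_prime2 // neq_ltn orbC q_gt3.
have q3 : (q %% 3 = 1 \/ q %% 3 = 2)%N.
  by move: cop; rewrite coprime_sym prime_coprime // /dvdn; lia.
have q0 := prime_gt0 prq.
set G := _ * _.
have eqG : psi 3 * G = (psi 3 * h) \Po 'X^q.
  have := @Cyclotomic_primeM 3 q 0 isT prq cop; rewrite expn1 expn0 comp_polyXr.
  by rewrite comp_polyM => <-; rewrite /G; ring.
have psi3M f : psi 3 * f = f + 'X * f + 'X^2 * f by rewrite psi3; ring.
have eqGc i : (G + 'X * G + 'X^2 * G)`_i =
    if (q %| i)%N then (h + 'X * h + 'X^2 * h)`_(i %/ q) else 0.
  by rewrite -coef_comp_poly_Xn // -!psi3M eqG.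
have rec0 : G`_0 = h`_0.
  move: (eqGc 0%N); rewrite dvdn0 div0n !coefD !coefXM !coefXnM /=.
  by rewrite !addr0.
have rec1 : G`_1 + G`_0 = 0.
  by move: (eqGc 1%N); rewrite dvdn1 !coefD !coefXM !coefXnM /= addr0 gtn_eqF 1?ltnW 1?ltnW.
have rec2 i : G`_i.+2 + G`_i.+1 + G`_i = 
    if (q %| i.+2)%N then h`_(i.+2 %/ q) + ('X * h)`_(i.+2 %/ q) + ('X^2 * h)`_(i.+2 %/ q) else 0.
  by rewrite -!coefD -eqGc !coefD !coefXM !coefXnM /= subn2.
have [n le_n] := ubnP (j * q + r).
elim: n j r le_n => // n IH j r le_n lt_rq.
case: r le_n lt_rq => [|[|r]] le_n lt_rq.
(* At the start of a block the recurrence reaches back to the last two coefficients of the previous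
   block; [q] mod 3 decides which branches of [tri] give them. *)
- case: j le_n => [|j] le_n; first by rewrite rec0 coefXM /= /tri !addr0; case: ifP.
  have e2 : (j.+1 * q + 0 = (j * q + (q - 2)).+2)%N by lia.
  have e1 : ((j * q + (q - 2)).+1 = j * q + (q - 1))%N by lia.
  have := rec2 (j * q + (q - 2))%N; rewrite -e2 e1 addn0 dvdn_mull // mulnK //.
  rewrite !IH; try lia.
  rewrite coefXnM coefXM /= subSS.
  rewrite /tri; case: q3 => q3; rewrite q3 /=.
    have -> : ((q - 1) %% 3 = 0)%N by lia.
    have -> : ((q - 2) %% 3 = 2)%N by lia.
    rewrite /= coefXM; case: j {e1 e2 le_n} => [|j]; rewrite /= ?subSS ?subn0; lra.
  have -> : ((q - 1) %% 3 = 1)%N by lia.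
  have -> : ((q - 2) %% 3 = 0)%N by lia.
  rewrite /= coefXM; case: j {e1 e2 le_n} => [|j]; rewrite /= ?subSS ?subn0; lra.
- case: j le_n => [|j] le_n.
    move: rec1; rewrite rec0 coefXM /tri /=; case: ifP => _; lra.
  have e2 : (j.+1 * q + 1 = (j * q + (q - 1)).+2)%N by lia.
  have e1 : ((j * q + (q - 1)).+1 = j.+1 * q + 0)%N by lia.
  have ndv : (q %| j.+1 * q + 1)%N = false.
    by rewrite dvdn_addr ?dvdn_mull // dvdn1 gtn_eqF //; lia.
  have := rec2 (j * q + (q - 1))%N; rewrite -e2 e1 ndv (IH j (q - 1)%N) ?(IH j.+1 0%N); try lia.
  rewrite /tri; case: q3 => q3; rewrite q3 /=.
    have -> : ((q - 1) %% 3 = 0)%N by lia.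
    rewrite !coefXM /=; lra.
  have -> : ((q - 1) %% 3 = 1)%N by lia.
  rewrite !coefXM /=; lra.
have ndv : (q %| (j * q + r).+2)%N = false.
  rewrite -!addnS dvdn_addr ?dvdn_mull //; apply/negP => /dvdn_leq; lia.
have := rec2 (j * q + r)%N; rewrite ndv -!addnS (IH j r) ?(IH j r.+1); try lia.
rewrite /tri.
have [|[|]] : (r %% 3 = 0 \/ r %% 3 = 1 \/ r %% 3 = 2)%N by lia.
- move=> r3; have -> : (r.+1 %% 3 = 1)%N by lia.
  have -> : (r.+2 %% 3 = 2)%N by lia.
  by rewrite r3 /=; case: ifP => _; lra.
- move=> r3; have -> : (r.+1 %% 3 = 2)%N by lia.
  have -> : (r.+2 %% 3 = 0)%N by lia.
  by rewrite r3 /=; case: ifP => _; lra.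
move=> r3; have -> : (r.+1 %% 3 = 0)%N by lia.
have -> : (r.+2 %% 3 = 1)%N by lia.
by rewrite r3 /=; case: ifP => _; lra.
Qed.

Lemma coef_le_Phi3 q h M : prime q -> (3 < q)%N ->
  coef_le M h -> coef_le M (psi 2 * h) -> coef_le M ('Phi_(3 * q) * (h \Po 'X^q)).
Proof.
move=> prq q_gt3 le_h le_h2 i; have q0 := prime_gt0 prq.
rewrite (divn_eq i q) coef_Phi3 ?ltn_pmod //.
have := coef_le_X le_h (i %/ q)%N; have := le_h (i %/ q)%N; have := le_h2 (i %/ q)%N.
rewrite psi2 mulrDl mul1r coefD /tri.
move: (h`__) (('X * h)`__) => z y.
by do 3?case: ifP => _; lia.
Qed.

(** The three values of [tri] sum to zero, so inside a block an adjacent sum is minus the third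
    value. The largest differences have the shape [2z + y] or [z + 2y], whence the factor 3. *)
Lemma coef_le_Phi3_adjacent q h M : prime q -> (3 < q)%N -> coef_le M h ->
  let G := 'Phi_(3 * q) * (h \Po 'X^q) in
  coef_le (2 * M) (psi 2 * G) /\ coef_le (3 * M) (('X - 1) * G).
Proof.
move=> prq q_gt3 le_h G; have q0 := prime_gt0 prq.
have q3 : (q %% 3 = 1 \/ q %% 3 = 2)%N.
  have : coprime 3 q by rewrite prime_coprime // dvdn_prime2 // neq_ltn q_gt3.
  by rewrite prime_coprime // /dvdn; lia.
suff adj i : (`|(G`_i + ('X * G)`_i)%R| <= 2 * M)%N /\
    (`|(('X * G)`_i - G`_i)%R| <= 3 * M)%N.
  split=> i; have [le_D le_B] := adj i; last by rewrite mulrBl mul1r coefB.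
  by rewrite psi2 mulrDl mul1r coefD.
have le_X := coef_le_X le_h.
have [j [r [lt_r ->]]] : exists j r, (r < q)%N /\ i = (j * q + r)%N.
  by exists (i %/ q)%N, (i %% q)%N; rewrite ltn_pmod // -divn_eq.
rewrite coef_Phi3 // (coefXM G).
have := le_X j; have := le_h j.
case: r lt_r => [|r] lt_r; last first.
  rewrite !addnS /= coef_Phi3 ?(ltnW lt_r) //.
  move: (h`__) (('X * h)`__) => z y le_z le_y; rewrite /tri.
  have [|[|]] : (r %% 3 = 0 \/ r %% 3 = 1 \/ r %% 3 = 2)%N by lia.
  - move=> r3; have -> : (r.+1 %% 3 = 1)%N by lia.
    by rewrite r3 /=; case: ifP => _; lia.
  - move=> r3; have -> : (r.+1 %% 3 = 2)%N by lia.
    by rewrite r3 /=; case: ifP => _; lia.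
  move=> r3; have -> : (r.+1 %% 3 = 0)%N by lia.
  by rewrite r3 /=; case: ifP => _; lia.
case: j => [|j].
  rewrite mul0n (coefXM h) /= /tri /=.
  by move: (h`__) => z le_z _; case: ifP => _; lia.
(* Across a block boundary the two neighbours are [h_j] and [h_(j+1)] if [q = 1 mod 3], and [-h_j]
   and [h_(j+1) + h_j] otherwise. *)
have -> : (j.+1 * q + 0 == 0)%N = false by lia.
have -> : ((j.+1 * q + 0).-1 = j * q + (q - 1))%N by lia.
rewrite coef_Phi3 ?subn1 ?prednK // (coefXM h j.+1) /=.
have := le_X j; have := le_h j.
move: (h`__) (h`__) (('X * h)`__) => z y x le_z le_y le_x _.
rewrite /tri; case: q3 => q3; rewrite q3 /=.
  have -> : (q.-1 %% 3 = 0)%N by lia.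
  by rewrite /=; lia.
have -> : (q.-1 %% 3 = 1)%N by lia.
by rewrite /=; lia.
Qed.

(** Both bounds are carried through one induction: old adjacent sums, the coefficients of
    [psi 2 * g], control the new height, and twice the old height controls the new adjacent sums. *)
Lemma tower3_coef_le q b g : prime q -> (3 < q)%N -> tower 3 q b g ->
  coef_le (2 ^ (b %/ 2)) g /\ coef_le (2 ^ (b.+1 %/ 2)) (psi 2 * g).
Proof.
move=> prq q_gt3.
have cop : coprime q 3.
  by rewrite prime_coprime // dvdn_prime2 // neq_ltn orbC q_gt3.
elim: b g => [|b IH] g /=.
  by case=> ->; split=> i; rewrite ?mulrN ?mulr1 ?psi2 ?coefN ?coefD coef1 ?coefX;
    case: i => [|[|i]].
case=> e [d [h [/IH[le_h le_h2] ->]]].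
have le_exp : (2 ^ (b %/ 2) <= 2 ^ (b.+1 %/ 2))%N by rewrite leq_exp2l // leq_div2r.
have expS : (2 ^ (b.+2 %/ 2) = 2 * 2 ^ (b %/ 2))%N by rewrite -expnS; congr (_ ^ _)%N; lia.
rewrite expS.
have [ed|] := boolP (e || ~~ d).
  have le_g := @coef_le_step 3 q h _ _ _ isT prq cop ed le_h.
  by split; [exact: coef_leW le_g | exact: coef_le_psi2].
rewrite negb_or negbK => /andP[/negbTE -> ->]; rewrite mul1r expr1; split.
  by apply: coef_le_Phi3 => //; exact: coef_leW le_h.
by have [] := coef_le_Phi3_adjacent prq q_gt3 le_h.
Qed.

Lemma tower3_large_coef q b : prime q -> (3 < q)%N ->
  exists g i, tower 3 q b g /\ `|(g`_i)%R|%N = (2 ^ (b %/ 2))%N.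
Proof.
move=> prq q_gt3; have q0 := prime_gt0 prq.
elim/ltn_ind: b => -[|[|b]] IH; try by exists 1, 0%N; split; [exact: tower_1 | rewrite coef1].
have [h [j [th hj]]] := IH b (ltnW (ltnSn _)).
pose h' := psi q * (h \Po 'X^q).
have h'j r : (r < q)%N -> h'`_(j * q + r) = h`_j.
  by move=> lt_r; rewrite coef_block ?size_psi // coef_psi lt_r mul1r.
have th' : tower 3 q b.+1 h' by exists true, false, h; rewrite expr1 mulr1.
have expS : (2 ^ (b.+2 %/ 2) = 2 * 2 ^ (b %/ 2))%N by rewrite -expnS; congr (_ ^ _)%N; lia.
(* Positions [j * q] and [j * q + 1] of [h'] lie in one constant block, and the offset, 1 or 0,
   selects the residue at which [tri] is their sum up to sign. *)
exists ('Phi_(3 * q) * (h' \Po 'X^q)), ((j * q + 1) * q + (q %% 3 == 1))%N; split.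
  by exists false, true, h'; rewrite mul1r expr1.
rewrite coef_Phi3 //; last by case: eqP => _; lia.
have h'0 : h'`_(j * q) = h`_j by rewrite -(h'j 0%N) ?addn0.
rewrite coefXM h'j ?(ltn_trans _ q_gt3) // addn1 /= h'0.
by rewrite /tri expS -hj; case: eqP => _ /=; lia.
Qed.

Lemma B_triple q b : prime q -> (3 < q)%N -> (0 < b)%N ->
  B (3 * q ^ b) = (3 * 2 ^ ((b - 1) %/ 2))%N.
Proof.
move=> prq q_gt3; have q0 := prime_gt0 prq.
have cop : coprime q 3.
  by rewrite prime_coprime // dvdn_prime2 // neq_ltn orbC q_gt3.
case: b => // b _; rewrite subn1 /=; apply/B_eq; first by rewrite muln_gt0 expn_gt0.
apply: is_max_height_coef.
  move=> f /Zdivides_XpqbP[]// e [d [g [[e' [d' [h [th ->]]]] ->]]].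
  have [le_h _] := tower3_coef_le prq q_gt3 th.
  set M := (2 ^ (b %/ 2))%N in le_h *.
  have le23 : (2 * M <= 3 * M)%N by rewrite leq_mul2r orbT.
  have leM3 : (M <= 3 * M)%N by rewrite leq_pmull.
  have [ed|] := boolP (e' || ~~ d').
    have le_g := @coef_le_step 3 q h _ _ _ isT prq cop ed le_h.
    move: (_ * (h \Po _)) le_g => {}g le_g.
    (* The outer factors [X^3 - 1], [X - 1], [psi_3] and 1 cost factors 2, 2, 3 and 1. *)
    case: e d => [] []; rewrite ?expr0 ?expr1 ?mul1r.
    - by rewrite mulrA psiE; apply: (coef_leW le23); exact: coef_le_Xn_sub1.
    - by apply: (coef_leW le23); exact: coef_le_X_sub1.
    - exact: coef_le_psi3.
    exact: coef_leW le_g.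
  rewrite negb_or negbK => /andP[/negbTE -> ->]; rewrite expr0 expr1 mul1r.
  have [le_2 le_D] := coef_le_Phi3_adjacent prq q_gt3 le_h.
  (* [psi 3] cancels the denominator of [Phi_(3q) = psi 3 (X^q) / psi 3]. *)
  have eqV : psi 3 * ('Phi_(3 * q) * (h \Po 'X^q)) = (psi 3 * h) \Po 'X^q.
    have := @Cyclotomic_primeM 3 q 0 isT prq cop; rewrite expn1 expn0 comp_polyXr.
    by rewrite comp_polyM => <-; ring.
  have le_V := coef_le_psi3 le_h.
  case: e d => [] []; rewrite ?expr0 ?expr1 ?mul1r ?eqV.
  (* Here ['X - 1] fits in one block, so only the factor 3 from [psi 3 * h] remains. *)
  - apply: coef_le_block => //.
      by rewrite size_XsubC; lia.
    by move=> i; rewrite coefB coefX coef1; case: i => [|[|i]].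
  - exact: le_D.
  - rewrite -[_ \Po _]mul1r; apply: coef_le_block => //; first by rewrite size_poly1.
    by move=> i; rewrite coef1; case: eqP.
  apply: (coef_leW le23); apply: coef_le_Phi3 => //; first by apply: coef_leW le_h; lia.
  exact: coef_le_psi2.
(* For the lower bound, [psi q] spreads a largest coefficient over a block of length [q], and
   [psi 3] adds three consecutive copies of it. *)
have [h [j [th hj]]] := tower3_large_coef b prq q_gt3.
pose g := psi q * (h \Po 'X^q).
have gj r : (r < q)%N -> g`_(j * q + r) = h`_j.
  by move=> lt_r; rewrite coef_block ?size_psi // coef_psi lt_r mul1r.
exists (psi 3 * g), (j * q + 2)%N; split.
  apply/Zdivides_XpqbP => //; exists false, true, g; split; last by rewrite mul1r expr1.
  by exists true, false, h; rewrite expr1 mulr1.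
rewrite psi3 !mulrDl mul1r !coefD coefXM coefXnM.
have -> : (j * q + 2 == 0)%N = false by lia.
have -> : (j * q + 2 < 2)%N = false by lia.
have -> : ((j * q + 2).-1 = j * q + 1)%N by lia.
have -> : ((j * q + 2) - 2 = j * q + 0)%N by lia.
by rewrite !gj ?(ltnW (ltnW q_gt3)) ?(ltnW q_gt3) // -hj; lia.
Qed.

Local Close Scope ring_scope.

Theorem theorem1p5 (p q : nat) (hp : prime p) (hq : prime q) (hpq : p < q)
  (b : nat) (hb : 0 < b) :
  (p = 2 -> B (p * q ^ b) = 2) /\
  (p = 3 -> B (p * q ^ b) = 3 * 2 ^ ((b - 1) %/ 2)).
Proof.
by split=> eq_p; rewrite eq_p in hpq *; [exact: B_double | exact: B_triple].
Qed.
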